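(* Let $M$ be a $G$-graded $R$-module and let $N$, $N'$ and $N_i$ ($i\in I$, where $I$ is an indexing set) be graded submodules of $M$. Then the following hold: (1) $\nu_G(0)=\mathcal{PS}_G(M)$ and $\nu_G(M)=\emptyset$. (2) $\bigcap_{i\in I}\nu_G(N_i)=\nu_G\left(\sum_{i\in I}(N_i:_R M)M\right)$. (3) $\nu_G(N)\cup\nu_G(N')=\nu_G(N\cap N')$. (4) If $N\subseteq N'$, then $\nu_G(N')\subseteq\nu_G(N)$.
   Context: $G$ is a multiplicative group, $R=\bigoplus_{g\in G}R_g$ is a commutative $G$-graded ring with identity ($R_gR_h\subseteq R_{gh}$), and $M=\bigoplus_{g\in G}M_g$ is a $G$-graded $R$-module ($R_gM_h\subseteq M_{gh}$). $h(R)=\bigcup_g R_g$ and $h(M)=\bigcup_g M_g$ are the sets of homogeneous elements. An ideal $I$ is graded if $I=\bigoplus_g(I\cap R_g)$; a submodule $N$ is graded if $N=\bigoplus_g(N\cap M_g)$. For a graded submodule $N$, $(N:_R M)=\{r\in R: rM\subseteq N\}$, a graded ideal of $R$. For a graded ideal $I$, the graded radical $Gr(I)$ is the set of all $a=\sum_g a_g\in R$ such that for each $g$ there is $n_g>0$ with $a_g^{n_g}\in I$. A proper graded submodule $P$ of $M$ is graded prime if for $r\in h(R)$, $m\in h(M)$, $rm\in P$ implies $m\in P$ or $r\in(P:_R M)$. $Spec_G(M)$ is the set of graded prime submodules of $M$. A proper graded submodule $Q$ is graded primary if for $r\in h(R)$, $m\in h(M)$, $rm\in Q$ implies $m\in Q$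 or $r\in Gr((Q:_R M))$. For a graded submodule $N$, $Gr_M(N)$ is the intersection of all graded prime submodules of $M$ containing $N$, with $Gr_M(N)=M$ if there are none. The graded primary spectrum $\mathcal{PS}_G(M)$ is the set of all graded primary submodules $Q$ of $M$ with $(Gr_M(Q):_R M)=Gr((Q:_R M))$. For a graded submodule $N$ of $M$, $\nu_G(N)=\{Q\in\mathcal{PS}_G(M): (N:_R M)\subseteq(Gr_M(Q):_R M)\}$. Standing assumption: $Spec_G(M)$ and $\mathcal{PS}_G(M)$ are non-empty. *)

(* Defs.v *)
From HB Require Import structures.
From mathcomp Require Import all_boot all_algebra.
From mathcomp Require Import all_classical.

Set Implicit Arguments.
Unset Strict Implicit.
Unset Printing Implicit Defensive.

Import GRing.Theory.

Local Open Scope classical_set_scope.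
Local Open Scope ring_scope.

(* Ideals and submodules are classical sets; [in N] turns the set N into a
   collective predicate, so that the closure conditions of ssralg apply. *)

Section DirectSum.
Variables (G : choiceType) (V : zmodType).

(* The finiteness clause is essential: \sum_(g \in [set: G]) f g is 0 by
   convention when f has infinite support. *)
Definition decomposes (A : G -> set V) (x : V) (f : G -> V) : Prop :=
  [/\ finite_set [set g | f g != 0],
      forall g, A g (f g)
    & x = \sum_(g \in [set: G]) f g].

(* U is the internal direct sum of the additive subgroups A g. *)
Definition is_direct_sum (U : set V) (A : G -> set V) : Prop :=
  [/\ forall g, zmod_closed [in A g],
      U = [set x | exists f, decomposes A x f]
    & forall x f f', decomposes A x f -> decomposes A x f' -> f = f'].

Definition homogeneous (A : G -> set V) : set V := \bigcup_g A g.

End DirectSum.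

Section Gradings.
Variables (G : groupType) (R : comPzRingType) (M : lmodType R).

Definition ring_grading (Rg : G -> set R) : Prop :=
  is_direct_sum [set: R] Rg /\
  forall g h r s, Rg g r -> Rg h s -> Rg (g * h)%g (r * s).

Definition module_grading (Rg : G -> set R) (Mg : G -> set M) : Prop :=
  is_direct_sum [set: M] Mg /\
  forall g h r m, Rg g r -> Mg h m -> Mg (g * h)%g (r *: m).

Definition graded_submodule (Mg : G -> set M) (N : set M) : Prop :=
  submod_closed [in N] /\ is_direct_sum N (fun g => N `&` Mg g).

End Gradings.

Section Submodules.
Variables (R : comPzRingType) (M : lmodType R).

(* (N :_R M) *)
Definition colon (N : set M) : set R := [set r | forall m, N (r *: m)].

(* The submodule J M, consisting of the finite sums of products r m. *)
Definition ideal_mul (J : set R) : set M :=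
  [set x | exists n (r : 'I_n -> R) (m : 'I_n -> M),
    (forall j, J (r j)) /\ x = \sum_(j < n) r j *: m j].

(* The sum of a family of submodules: the indices k j may repeat, which is
   harmless as each N i is closed under addition. *)
Definition sum_submodules (I : Type) (N : I -> set M) : set M :=
  [set x | exists n (k : 'I_n -> I) (y : 'I_n -> M),
    (forall j, N (k j) (y j)) /\ x = \sum_(j < n) y j].

End Submodules.

Section PrimarySpectrum.
Variables (G : groupType) (R : comPzRingType) (M : lmodType R).
Variables (Rg : G -> set R) (Mg : G -> set M).

Definition graded_radical (J : set R) : set R :=
  [set a | exists f, decomposes Rg a f /\
    forall g, exists2 n, (0 < n)%N & J (f g ^+ n)].

Definition graded_prime (P : set M) : Prop :=
  [/\ graded_submodule Mg P,
      P != [set: M]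
    & forall r m, homogeneous Rg r -> homogeneous Mg m ->
        P (r *: m) -> P m \/ colon P r].

Definition graded_spectrum : set (set M) := [set P | graded_prime P].

Definition graded_primary (Q : set M) : Prop :=
  [/\ graded_submodule Mg Q,
      Q != [set: M]
    & forall r m, homogeneous Rg r -> homogeneous Mg m ->
        Q (r *: m) -> Q m \/ graded_radical (colon Q) r].

(* Gr_M(N); the empty intersection is the whole module. *)
Definition module_radical (N : set M) : set M :=
  \bigcap_(P in [set P | graded_prime P /\ N `<=` P]) P.

(* PS_G(M) *)
Definition primary_spectrum : set (set M) :=
  [set Q | graded_primary Q /\
    colon (module_radical Q) = graded_radical (colon Q)].

(* nu_G(N), as a set of sets of M. Intersections of such sets are taken inside
   primary_spectrum, so that the empty intersection is primary_spectrum. *)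
Definition variety (N : set M) : set (set M) :=
  [set Q | primary_spectrum Q /\ colon N `<=` colon (module_radical Q)].

End PrimarySpectrum.

(* Main.v *)
(* The colon ideals are monotone and commute with intersections, which gives
   everything but the inclusion of nu(N meet N') in the union. For that inclusion,
   (N : M) and (N' : M) are graded ideals, so if neither lies in
   p = (Gr_M(Q) : M) then each has a homogeneous element outside p; their
   product lies in (N meet N' : M). This contradicts that p = Gr((Q : M)) is prime
   on homogeneous elements, as Q is graded primary. *)

Require Import Defs.
From mathcomp Require Import all_boot all_algebra finmap.
From mathcomp Require Import all_classical.

Import GRing.Theory.

Local Open Scope classical_set_scope.
Local Open Scope ring_scope.

(** * Decompositions along an internal direct sum *)

Section DirectSums.
Context {G : choiceType} {V : zmodType}.
Implicit Types (A : G -> set V) (f : G -> V) (S : set V).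

Lemma fsum_ind S f : S 0 -> (forall x y, S x -> S y -> S (x + y)) ->
  (forall g, S (f g)) -> S (\sum_(g \in [set: G]) f g).
Proof. by move=> S0 SD Sf; apply: big_ind. Qed.

Lemma decomposes_homogeneous {A g x} :
  (forall h, A h 0) -> A g x ->
  decomposes A x (fun h => if h == g then x else 0).
Proof.
move=> A0 Agx; split=> [|h|].
- apply: (@sub_finite_set _ _ [set g]); last exact: finite_set1.
  by move=> h /=; case: (eqVneq h g) => // _ /eqP.
- by case: (eqVneq h g) => [->|].
- rewrite (fsbigTE [fset g]%fset) ?big_seq_fset1 ?eqxx // => h.
  by rewrite inE => /negPf ->.
Qed.

Lemma direct_sum0 {U A} : is_direct_sum U A -> forall g, A g 0.
Proof. by case=> clA _ _ g; have [/set_mem] := clA g. Qed.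

Lemma direct_sum_decomposes {U A x} :
  is_direct_sum U A -> U x -> exists f, decomposes A x f.
Proof. by case=> _ -> _. Qed.

Lemma decomposes_uniq {U A x f f'} :
  is_direct_sum U A -> decomposes A x f -> decomposes A x f' -> f = f'.
Proof. by case=> _ _; apply. Qed.

End DirectSums.

(** * Submodules, colon ideals and their ordinary radicals *)

Section Submodules.
Context {R : comPzRingType} {M : lmodType R}.
Implicit Types (N : set M).

Lemma submod0 {N} : submod_closed [in N] -> N 0.
Proof. by case=> /set_mem. Qed.

Lemma submodZD {N} : submod_closed [in N] ->
  forall a u v, N u -> N v -> N (a *: u + v).
Proof.
case=> _ cl a u v Nu Nv.
by apply/set_mem/cl; apply: mem_set.
Qed.

Lemma submodZ {N} a {u} : submod_closed [in N] -> N u -> N (a *: u).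
Proof.
by move=> cl Nu; rewrite -[_ *: _]addr0; apply: submodZD (submod0 cl).
Qed.

Lemma submodD {N u v} : submod_closed [in N] -> N u -> N v -> N (u + v).
Proof. by move=> cl Nu Nv; rewrite -[u]scale1r; apply: submodZD. Qed.

Lemma submod_sum {N} n (y : 'I_n -> M) : submod_closed [in N] ->
  (forall j, N (y j)) -> N (\sum_(j < n) y j).
Proof.
move=> cl Ny; apply: big_ind => //; first exact: submod0.
by move=> u v; apply: submodD.
Qed.

Lemma colonS {N N'} : N `<=` N' -> colon N `<=` colon N'.
Proof. by move=> sNN' r Nr m; apply/sNN'/Nr. Qed.

Lemma colon_setI N N' : colon (N `&` N') = colon N `&` colon N'.
Proof.
by apply/seteqP; split=> r /=; [move=> NNr; split=> m; case: (NNr m)|case].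
Qed.

Lemma colonD {N r s} :
  submod_closed [in N] -> colon N r -> colon N s -> colon N (r + s).
Proof. by move=> cl Nr Ns m; rewrite scalerDl; apply: submodD. Qed.

Lemma colonM {N} a {r} : submod_closed [in N] -> colon N r -> colon N (a * r).
Proof. by move=> cl Nr m; rewrite -scalerA; apply: submodZ. Qed.

Lemma colon0 {N} : submod_closed [in N] -> colon N 0.
Proof. by move=> cl m; rewrite scale0r; apply: submod0. Qed.

(** Every term of the binomial expansion of [(r + s) ^+ (n + k)] contains either the factor [r ^+ n]
    or the factor [s ^+ k]. *)
Lemma colon_radicalD {N r s} : submod_closed [in N] ->
  (exists n, colon N (r ^+ n)) -> (exists n, colon N (s ^+ n)) ->
  exists n, colon N ((r + s) ^+ n).
Proof.
move=> cl [n Nr] [k Ns]; exists (n + k)%N; rewrite exprDn.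
apply: big_ind => [|x y|i _]; [exact: colon0|exact: colonD|].
(* The binomial coefficient becomes a ring factor, absorbed by the ideal. The remaining term is
   [r ^+ (n + k - i) * s ^+ i]: it has the factor [s ^+ k] if [k <= i], and [r ^+ n] otherwise. *)
rewrite -mulr_natl; apply: colonM => //.
have [le_ki|/ltnW le_ik] := leqP k i.
  by rewrite -[in s ^+ _](subnK le_ki) exprD mulrA; apply: colonM.
by rewrite -addnBA // exprD -mulrA mulrC; apply: colonM.
Qed.

End Submodules.

(** * Graded radicals and homogeneous elements *)

Section Gradings.
Context {G : groupType} {R : comPzRingType} {M : lmodType R}.
Context {Rg : G -> set R} {Mg : G -> set M}.
Hypotheses (gradR : ring_grading Rg) (gradM : module_grading Rg Mg).
Implicit Types (N Q : set M).

(* Binomially, powers of the homogeneous components combine: the graded radical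
   lies in the usual one. In particular it contains 1 only if the ideal does. *)
Lemma graded_radical_expr {N x} : submod_closed [in N] ->
  graded_radical Rg (colon N) x -> exists n, colon N (x ^+ n).
Proof.
move=> cl [f [[_ _ ->] fN]].
apply: (@fsum_ind _ _ [set a | exists n, colon N (a ^+ n)]) => [|r s|g] /=.
- by exists 1%N; rewrite expr1; apply: colon0.
- exact: colon_radicalD.
- by have [n _ Nfn] := fN g; exists n.
Qed.

Lemma expr_graded_radical {N x n} : submod_closed [in N] ->
  homogeneous Rg x -> colon N (x ^+ n) -> graded_radical Rg (colon N) x.
Proof.
move=> cl [g _ Rgx] Nxn; exists (fun h => if h == g then x else 0).
split; first exact: (decomposes_homogeneous (direct_sum0 gradR.1) Rgx).
(* The graded radical asks for positive exponents, while [n] may be 0; a positive exponent also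
   makes the powers of the zero components vanish. *)
move=> h; exists n.+1 => //.
case: ifP => _; first by rewrite exprS; apply: colonM.
by rewrite expr0n; apply: colon0.
Qed.

Lemma homogeneousM {r s} :
  homogeneous Rg r -> homogeneous Rg s -> homogeneous Rg (r * s).
Proof.
case=> g _ Rr [h _ Rs]; exists (g * h)%g => //; exact: gradR.2.
Qed.

Lemma homogeneousZ {r m} :
  homogeneous Rg r -> homogeneous Mg m -> homogeneous Mg (r *: m).
Proof.
case=> g _ Rr [h _ Ms]; exists (g * h)%g => //; exact: gradM.2.
Qed.

Lemma homogeneousXn {r} n : homogeneous Rg r -> homogeneous Rg (r ^+ n.+1).
Proof.
move=> hr; elim: n => [|n IHn]; first by rewrite expr1.
by rewrite exprS; apply: homogeneousM.
Qed.

(** * Colon ideals tested on homogeneous elements *)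

Lemma colon_homogeneous {N r} : submod_closed [in N] ->
  (forall m, homogeneous Mg m -> N (r *: m)) -> colon N r.
Proof.
move=> cl Nr m.
have [f [_ Mf ->]] := direct_sum_decomposes gradM.1 (I : [set: M] m).
apply: (@fsum_ind _ _ [set u | N (r *: u)]) => [|u v|g] /=.
- by rewrite scaler0; apply: submod0.
- by rewrite scalerDr; apply: submodD.
- by apply: Nr; exists g.
Qed.

(** Multiplication by [m] of degree [h] shifts degrees from [g] to [g * h], so the component of
    [r *: m] in degree [g] comes from degree [g * h^-1] of [r]. *)
Lemma decomposes_scale {r m f h} : decomposes Rg r f -> Mg h m ->
  decomposes Mg (r *: m) (fun g => f (g * h^-1)%g *: m).
Proof.
move=> [finf Rf ->] Mm; split=> [|g|].
- apply: (sub_finite_set _ (finite_image (fun g => g * h)%g finf)) => g /=.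
  move=> nz; exists (g * h^-1)%g; last by rewrite mulgVK.
  by apply: contraNneq nz => ->; rewrite scale0r.
- by rewrite -{1}(mulgVK h g); apply: gradM.2.
- have bij_mulh : bijective (fun g => g * h)%g.
    by exists (fun g => g * h^-1)%g => g; rewrite ?mulgK ?mulgVK.
  rewrite [RHS](reindex_fsbigT _ _ bij_mulh) /=.
  under [RHS]eq_fsbigr do rewrite mulgK.
  (* Scaling distributes over finite sums, so both sums are first restricted to the finite support
     of [f]. *)
  have f0 g : g \notin fset_set [set g | f g != 0] -> f g = 0.
    rewrite in_fset_set // => /negP; apply: contra_notP => /eqP ?.
    exact: mem_set.
  rewrite !(fsbigTE (fset_set [set g | f g != 0])) ?scaler_suml // => g /f0 -> //.
  by rewrite scale0r.
Qed.

(** This is why [colon N] is a graded ideal: for [m] of degree [h], the element [f g *: m] is the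
    component of [r *: m] in degree [g * h], and a graded submodule contains the components of its
    elements. *)
Lemma colon_component {N r f} : graded_submodule Mg N ->
  decomposes Rg r f -> colon N r -> forall g, colon N (f g).
Proof.
move=> [cl gradN] df Nr g; apply: colon_homogeneous => // m [h _ Mm].
have [f' [finf' NMf' e]] := direct_sum_decomposes gradN (Nr m).
(* A decomposition inside [N] is also one inside [M], where uniqueness identifies it with the
   shifted decomposition. *)
have df' : decomposes Mg (r *: m) f' by split=> // k; have [] := NMf' k.
have /(congr1 (fun F => F (g * h)%g)) :=
  decomposes_uniq gradM.1 (decomposes_scale df Mm) df'.
by rewrite mulgK => ->; have [] := NMf' (g * h)%g.
Qed.

Lemma module_radical_submod Q : submod_closed [in module_radical Rg Mg Q].
Proof.
split; first by apply/mem_set => P [[[cl _] _ _] _]; apply: submod0.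
move=> a u v /set_mem Qu /set_mem Qv; apply/mem_set => P PP.
by have [[[cl _] _ _] _] := PP; apply: submodZD => //; [apply: Qu|apply: Qv].
Qed.

(** An element of [colon N] is the sum of its homogeneous components, which lie in [colon N] too; if
    all of them were in [colon Q], so would be their sum. *)
Lemma not_colon_homogeneous {N Q} : graded_submodule Mg N ->
  submod_closed [in Q] -> ~ colon N `<=` colon Q ->
  exists r, [/\ homogeneous Rg r, colon N r & ~ colon Q r].
Proof.
move=> gradN clQ; apply: contra_notP => noex r Nr.
have [f df] := direct_sum_decomposes gradR.1 (I : [set: R] r).
have [_ Rf ->] := df.
apply: fsum_ind => [|x y|g]; [exact: colon0|exact: colonD|].
apply: contra_notP noex => nQ; exists (f g); split=> //; first by exists g.
exact: (colon_component gradN df Nr).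
Qed.

Lemma primary_radical_prime {Q r s} : graded_primary Rg Mg Q ->
  homogeneous Rg r -> homogeneous Rg s ->
  graded_radical Rg (colon Q) (r * s) ->
  graded_radical Rg (colon Q) r \/ graded_radical Rg (colon Q) s.
Proof.
move=> [[cl _] _ primQ] hr hs /(graded_radical_expr cl)[n].
(* One more factor [r * s] makes the exponent positive, as [homogeneousXn] requires. *)
move=> /(colonM (r * s) cl); rewrite -exprS exprMn => Qrs.
have [Qs|nQs] := pselect (colon Q (s ^+ n.+1)).
  by right; apply: expr_graded_radical Qs.
left; apply: contra_notP nQs => nQr; apply: colon_homogeneous => // m hm.
(* The primary condition is applied to the scalar [r ^+ n.+1] and the homogeneous element
   [s ^+ n.+1 *: m]. *)
have [//|] : Q (s ^+ n.+1 *: m) \/ graded_radical Rg (colon Q) (r ^+ n.+1).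
  apply: primQ; [exact: homogeneousXn|apply: homogeneousZ hm|].
    exact: homogeneousXn.
  by rewrite scalerA.
move=> /(graded_radical_expr cl)[k]; rewrite -exprM => Qrk.
by case: nQr; apply: expr_graded_radical Qrk.
Qed.

(** * The identities between varieties *)

Lemma varietyS N N' : colon N `<=` colon N' ->
  variety Rg Mg N' `<=` variety Rg Mg N.
Proof. by move=> sNN' Q [psQ sN'Q]; split=> // r /sNN'; apply: sN'Q. Qed.

Lemma variety0 : variety Rg Mg [set 0] = primary_spectrum Rg Mg.
Proof.
apply/seteqP; split=> [Q []//|Q psQ]; split=> // r r0 m.
by rewrite r0; apply: submod0 (module_radical_submod Q).
Qed.

(** A member [Q] would have 1 in the graded radical of [colon Q], hence 1 in [colon Q],
    contradicting that [Q] is proper. *)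
Lemma varietyT : variety Rg Mg [set: M] = set0.
Proof.
rewrite -subset0 => Q [[[[cl _] /eqP properQ _] eqrad] sTQ].
apply: properQ; apply/seteqP; split=> // m _.
have : colon (module_radical Rg Mg Q) 1 by apply: sTQ.
rewrite eqrad => /(graded_radical_expr cl)[n].
by rewrite expr1n => /(_ m); rewrite scale1r.
Qed.

Lemma bigcap_variety (K : Type) (N : K -> set M) :
  primary_spectrum Rg Mg `&` \bigcap_(i in [set: K]) variety Rg Mg (N i) =
  variety Rg Mg (sum_submodules (fun i => ideal_mul (M := M) (colon (N i)))).
Proof.
apply/seteqP; split=> Q [psQ sNQ].
  (* It suffices that the sum lies in the radical of [Q], a submodule that contains each generator
     [r *: m] with [r] in some [colon (N i)]. *)
  split=> //; apply: colonS => x [n [k [y [NMy ->]]]].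
  have clQ := module_radical_submod Q.
  apply: submod_sum => // j; have [p [r [m [Nr ->]]]] := NMy j.
  by apply: submod_sum => // l; have [_] := sNQ (k j) I; apply.
(* Conversely, [colon (N i)] lies in the colon ideal of the sum, since each [r *: m] is a sum with a
   single term. *)
split=> // i _; split=> // r Nr; apply: sNQ => m.
exists 1%N, (fun=> i), (fun=> r *: m); split; last by rewrite big_ord1.
by move=> _; exists 1%N, (fun=> r), (fun=> m); rewrite big_ord1.
Qed.

Lemma variety_setI N N' : graded_submodule Mg N -> graded_submodule Mg N' ->
  variety Rg Mg N `|` variety Rg Mg N' = variety Rg Mg (N `&` N').
Proof.
move=> gradN gradN'; apply/seteqP; split.
  by rewrite subUset; split; apply: varietyS; rewrite colon_setI => r [].
move=> Q [psQ sNNQ].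
have clQ := module_radical_submod Q.
have [sNQ|/(not_colon_homogeneous gradN clQ)[r [hr Nr nQr]]] :=
  pselect (colon N `<=` colon (module_radical Rg Mg Q)); first by left.
have [sNQ'|/(not_colon_homogeneous gradN' clQ)[s [hs Ns nQs]]] :=
  pselect (colon N' `<=` colon (module_radical Rg Mg Q)); first by right.
have : colon (module_radical Rg Mg Q) (r * s).
  apply: sNNQ; rewrite colon_setI; split; last exact: colonM gradN'.1 Ns.
  by rewrite mulrC; apply: colonM gradN.1 Nr.
(* Membership of [Q] in the primary spectrum turns the colon ideal of its radical into the graded
   radical of [colon Q], where primality on homogeneous elements is known. *)
have [primQ eqrad] := psQ; rewrite eqrad in nQr nQs *.
by case/(primary_radical_prime primQ hr hs).
Qed.

End Gradings.

Theorem theorem2p4 (G : groupType) (R : comPzRingType) (M : lmodType R)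
    (Rg : G -> set R) (Mg : G -> set M)
    (gradR : ring_grading Rg) (gradM : module_grading Rg Mg)
    (spec_neq0 : graded_spectrum Rg Mg !=set0)
    (pspec_neq0 : primary_spectrum Rg Mg !=set0)
    (N N' : set M) (I : Type) (Ni : I -> set M)
    (gradN : graded_submodule Mg N) (gradN' : graded_submodule Mg N')
    (gradNi : forall i, graded_submodule Mg (Ni i)) :
  [/\ variety Rg Mg [set 0] = primary_spectrum Rg Mg /\
        variety Rg Mg [set: M] = set0,
      primary_spectrum Rg Mg `&`
          \bigcap_(i in [set: I]) variety Rg Mg (Ni i) =
        variety Rg Mg
          (sum_submodules (fun i => ideal_mul (M := M) (colon (Ni i)))),
      variety Rg Mg N `|` variety Rg Mg N' = variety Rg Mg (N `&` N')
    & N `<=` N' -> variety Rg Mg N' `<=` variety Rg Mg N].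
Proof.
split; first by split; [exact: variety0|exact: varietyT].
- exact: bigcap_variety.
- exact: variety_setI.
- by move=> sNN'; apply/varietyS/colonS.
Qed.
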